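(* Let $A \in \mathbb{R}^{m\times n}$, $b \in \mathbb{R}^m$, $c \in \mathbb{R}^n$, $\ell, u \in \overline{\mathbb{R}}^n$ and $\mathcal{I} \subseteq \mathcal{N} := \{1,\dots,n\}$ be the data of the mixed integer program $$\min\{ c^{\mathsf T}x \mid Ax \ge b,\ \ell \le x \le u,\ x_j \in \mathbb{Z}\ \forall j \in \mathcal{I}\}.$$ Let $\ell', u' \in \overline{\mathbb{R}}^n$ be the local variable bounds of a subproblem whose LP relaxation $\min\{c^{\mathsf T}x \mid Ax \ge b,\ \ell' \le x \le u',\ x \in \mathbb{R}^n\}$ is infeasible, let $(y,r) \in \mathbb{R}^m_+ \times \mathbb{R}^n$ be a dual ray proving the infeasibility of this local subproblem, and let $(y^{\mathsf T}A)x \ge y^{\mathsf T}b$ be the Farkas proof (conflict constraint) derived from it. Let $j \in \mathcal{N}$. If the conflict constraint $(y^{\mathsf T}A)x \ge y^{\mathsf T}b$ contributes to the conflict up-locks (respectively, conflict down-locks) of $j$, then there exists at least one model constraint, i.e. a row $i \in \{1,\dots,m\}$ of $Ax \ge b$, that contributes to the variable up-locks (respectively, variable down-locks) of $j$.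
   Context: Notation: $\overline{\mathbb{R}} := \mathbb{R}\cup\{\pm\infty\}$, and $\mathbb{R}^m_+$ is the set of componentwise nonnegative vectors. Dual ray: for local bounds $\ell', u'$, a dual ray proving infeasibility of the LP relaxation is a pair $(y,r) \in \mathbb{R}^m_+\times\mathbb{R}^n$ with $$y^{\mathsf T}A + r = 0, \qquad y^{\mathsf T}b + r\{\ell',u'\} > 0,$$ where $r\{\ell',u'\} := \sum_{j\in\mathcal{N}:\, r_j>0} r_j \ell'_j + \sum_{j\in\mathcal{N}:\, r_j<0} r_j u'_j$. The inequality $(y^{\mathsf T}A)x \ge y^{\mathsf T}b$ is called the Farkas proof; it is used as a conflict constraint. Variable locks: the number of down-locks of variable $j$ is $|\{i \mid A_{ij} > 0\}|$ and the number of up-locks of variable $j$ is $|\{i \mid A_{ij} < 0\}|$. That is, the model constraint given by row $i$ of $Ax \ge b$ contributes to the variable down-locks of $j$ if $A_{ij}>0$, and to the variable up-locks of $j$ if $A_{ij}<0$. Conflict locks: defined analogously, counting only conflict constraints instead of model constraints. That is, a conflict constraint $\bar a^{\mathsf T}x \ge \bar b$ contributes to the conflict down-locks of $j$ if $\bar a_j > 0$, and to the conflict up-locks of $j$ if $\bar a_j < 0$. *)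

(* Defs.v *)
From mathcomp Require Import all_boot all_order all_algebra.
From mathcomp Require Import reals constructive_ereal.

Set Implicit Arguments.
Unset Strict Implicit.
Unset Printing Implicit Defensive.

Import Order.TTheory GRing.Theory Num.Theory.
Local Open Scope ring_scope.

(* R : realType is the field of real numbers and \bar R the
   extended reals. Vectors are columns. *)

(* min { c^T x | A x >= b, l <= x <= u, x_j integer for j in I } *)
Record mip (R : realType) (m n : nat) := Mip {
  mip_A : 'M[R]_(m, n);
  mip_b : 'cV[R]_m;
  mip_c : 'cV[R]_n;
  mip_l : 'cV[\bar R]_n;
  mip_u : 'cV[\bar R]_n;
  mip_I : {set 'I_n} }.

(* Feasibility for the LP relaxation with the (local) bounds l' and u'. *)
Definition lp_feasible (R : realType) (m n : nat) (P : mip R m n)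
    (l' u' : 'cV[\bar R]_n) (x : 'cV[R]_n) : Prop :=
  (forall i : 'I_m, mip_b P i 0 <= (mip_A P *m x) i 0) /\
  (forall j : 'I_n, (l' j 0%R <= (x j 0%R)%:E)%E /\ ((x j 0%R)%:E <= u' j 0%R)%E).

Definition mip_feasible (R : realType) (m n : nat) (P : mip R m n)
    (x : 'cV[R]_n) : Prop :=
  lp_feasible P (mip_l P) (mip_u P) x /\
  (forall j : 'I_n, j \in mip_I P -> x j 0 \is a Num.int).

Definition mip_objective (R : realType) (m n : nat) (P : mip R m n)
    (x : 'cV[R]_n) : R :=
  ((mip_c P)^T *m x) 0 0.

Definition lp_infeasible (R : realType) (m n : nat) (P : mip R m n)
    (l' u' : 'cV[\bar R]_n) : Prop :=
  ~ exists x : 'cV[R]_n, lp_feasible P l' u' x.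

(* r{l', u'}. When l' < +oo and u' > -oo componentwise, no term is +oo, so the
   convention +oo + -oo = -oo of the library plays no role. *)
Definition ray_bound (R : realType) (n : nat) (r : 'cV[R]_n)
    (l' u' : 'cV[\bar R]_n) : \bar R :=
  (\sum_(j < n | (0 < r j 0)%R) (r j 0%R)%:E * l' j 0%R +
   \sum_(j < n | (r j 0 < 0)%R) (r j 0%R)%:E * u' j 0%R)%E.

Definition dual_ray (R : realType) (m n : nat) (P : mip R m n)
    (l' u' : 'cV[\bar R]_n) (y : 'cV[R]_m) (r : 'cV[R]_n) : Prop :=
  [/\ forall i : 'I_m, 0 <= y i 0,
      y^T *m mip_A P + r^T = 0 &
      (0 < ((y^T *m mip_b P) 0 0)%R%:E + ray_bound r l' u')%E].

(* The linear constraint lc_coef *m x >= lc_rhs. *)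
Record lin_constraint (R : realType) (n : nat) := LinConstraint {
  lc_coef : 'rV[R]_n;
  lc_rhs : R }.

Definition model_constraint (R : realType) (m n : nat) (P : mip R m n)
    (i : 'I_m) : lin_constraint R n :=
  LinConstraint (row i (mip_A P)) (mip_b P i 0).

Definition farkas_proof (R : realType) (m n : nat) (P : mip R m n)
    (y : 'cV[R]_m) : lin_constraint R n :=
  LinConstraint (y^T *m mip_A P) ((y^T *m mip_b P) 0 0).

Definition contributes_down (R : realType) (n : nat)
    (a : lin_constraint R n) (j : 'I_n) : bool :=
  0 < lc_coef a 0 j.

Definition contributes_up (R : realType) (n : nat)
    (a : lin_constraint R n) (j : 'I_n) : bool :=
  lc_coef a 0 j < 0.

(* Locks of j in a finite family F of constraints: the variable locks are those
   of F := model_constraint P, the conflict locks those of the family of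
   conflict constraints. *)
Definition down_locks (R : realType) (n : nat) (K : finType)
    (F : K -> lin_constraint R n) (j : 'I_n) : nat :=
  #|[set k | contributes_down (F k) j]|.

Definition up_locks (R : realType) (n : nat) (K : finType)
    (F : K -> lin_constraint R n) (j : 'I_n) : nat :=
  #|[set k | contributes_up (F k) j]|.

(* Main.v *)
Require Import Defs.
From mathcomp Require Import all_boot all_order all_algebra.
From mathcomp Require Import reals constructive_ereal.

Import Order.TTheory GRing.Theory Num.Theory.

(** The coefficient of [j] in the Farkas proof is the sum over the rows [i] of [y i 0] times the
    entry of [mip_A P] at [i], [j]. Since [y] is nonnegative, this sum can be negative (positive)
    only if some entry of column [j] is. *)

Theorem lemma2 (R : realType) (m n : nat) (P : mip R m n)
    (l' u' : 'cV[\bar R]_n)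
    (Hinf : lp_infeasible P l' u')
    (y : 'cV[R]_m) (r : 'cV[R]_n)
    (Hray : dual_ray P l' u' y r)
    (j : 'I_n) :
  (contributes_up (farkas_proof P y) j ->
     exists i : 'I_m, contributes_up (model_constraint P i) j) /\
  (contributes_down (farkas_proof P y) j ->
     exists i : 'I_m, contributes_down (model_constraint P i) j).
Proof.
case: Hray => y_ge0 _ _.
rewrite /contributes_up /contributes_down /= mxE.
(* Contraposition on the boolean existential over rows: if no entry of column [j] has the strict
   sign, all have the opposite weak sign, and so does the sum. *)
split=> sum_sign; apply/existsP; apply: contraLR sum_sign;
  rewrite negb_exists -leNgt => /forallP A_sign.
  apply: sumr_ge0 => i _; rewrite mxE mulr_ge0 //.
  by move: (A_sign i); rewrite mxE -leNgt.
apply: sumr_le0 => i _; rewrite mxE mulr_ge0_le0 //.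
by move: (A_sign i); rewrite mxE -leNgt.
Qed.
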